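(* For every $n$-vertex graph $G$ and every positive integer $k\ge 3$ with $n^{\frac{1}{(k+1)k^4}}> 2k^{4k^2+k+3}$, one can compute, in time $O(n^{6})$ (by a randomized procedure), a random graph $G'$ such that, with probability at least $\frac{9}{10}$, $G'$ contains a subgraph isomorphic to $K_{k^2,k^2}$ if and only if $G$ contains a subgraph isomorphic to $K_k$.
   Context: $K_k$ denotes the complete graph on $k$ vertices and $K_{a,b}$ the complete bipartite graph with parts of sizes $a$ and $b$. *)

(* Defs.v *)
From HB Require Import structures.
From mathcomp Require Import all_boot all_order all_algebra.
From mathcomp Require Import reals exp.

Set Implicit Arguments.
Unset Strict Implicit.
Unset Printing Implicit Defensive.

Import Order.TTheory GRing.Theory Num.Theory.

Local Open Scope nat_scope.

(* Finite simple graphs, always on the vertex set {0, ..., nverts - 1}. *)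
Record graph := Graph {
  nverts : nat;
  adj : rel 'I_nverts;
  adj_sym : symmetric adj;
  adj_irr : irreflexive adj
}.

Definition clique_adj (k : nat) : rel 'I_k := fun i j => i != j.

Lemma clique_adj_sym k : symmetric (@clique_adj k).
Proof. by move=> i j; rewrite /clique_adj eq_sym. Qed.

Lemma clique_adj_irr k : irreflexive (@clique_adj k).
Proof. by move=> i; rewrite /clique_adj eqxx. Qed.

Definition clique (k : nat) : graph :=
  Graph (@clique_adj_sym k) (@clique_adj_irr k).

(* The parts are {0, ..., a - 1} and {a, ..., a + b - 1}. *)
Definition biclique_adj (a b : nat) : rel 'I_(a + b) :=
  fun i j => (i < a) != (j < a).

Lemma biclique_adj_sym a b : symmetric (@biclique_adj a b).
Proof. by move=> i j; rewrite /biclique_adj eq_sym. Qed.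

Lemma biclique_adj_irr a b : irreflexive (@biclique_adj a b).
Proof. by move=> i; rewrite /biclique_adj eqxx. Qed.

Definition biclique (a b : nat) : graph :=
  Graph (@biclique_adj_sym a b) (@biclique_adj_irr a b).

(* [G] has a (not necessarily induced) subgraph isomorphic to [H]. *)
Definition contains (H G : graph) : bool :=
  [exists f : {ffun 'I_(nverts H) -> 'I_(nverts G)},
    injectiveb f && [forall x, forall y, adj x y ==> adj (f x) (f y)]].

(* Randomized word RAM, programmed with structured control flow. Registers and
   memory cells hold words, i.e. naturals below 2 ^ w; registers are named by
   numerals, a fixed program mentioning only finitely many of them. *)
Inductive binop := AddOp | SubOp | MulOp | DivOp | ModOp.

(* Subtraction is truncated at 0; division by 0 follows [divn] and [modn]. *)
Definition eval_binop (o : binop) : nat -> nat -> nat :=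
  match o with
  | AddOp => addn
  | SubOp => subn
  | MulOp => muln
  | DivOp => divn
  | ModOp => modn
  end.

Inductive cmd :=
  | Skip
  | Const of nat & nat               (* Const r v     : r := v          *)
  | Binop of binop & nat & nat & nat (* Binop o r a b : r := a o b      *)
  | Read of nat & nat                (* Read r a      : r := cell[a]    *)
  | Write of nat & nat               (* Write a r     : cell[a] := r    *)
  | Flip of nat                      (* Flip r        : r := fair coin  *)
  | Seq of cmd & cmd
  | If of nat & cmd & cmd            (* tests whether the register is nonzero *)
  | While of nat & cmd.              (* idem *)

(* [coins] is the unread part of the random tape. *)
Record state := State {
  reg : nat -> nat;
  cell : nat -> nat;
  coins : seq bool
}.

Definition set_reg (r v : nat) (s : state) : state :=
  State [eta reg s with r |-> v] (cell s) (coins s).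

Definition set_mem (a v : nat) (s : state) : state :=
  State (reg s) [eta cell s with a |-> v] (coins s).

(* A configuration pairs the stack of commands still to be executed with the
   state; it is halted when the stack is empty. *)
Definition config := (seq cmd * state)%type.

(* One unit of time. Results are reduced modulo 2 ^ w. *)
Definition step (w : nat) (cf : config) : config :=
  let: (stack, s) := cf in
  if stack isn't c :: K then cf else
  match c with
  | Skip => (K, s)
  | Const r v => (K, set_reg r (v %% 2 ^ w) s)
  | Binop o r a b => (K, set_reg r (eval_binop o (reg s a) (reg s b) %% 2 ^ w) s)
  | Read r a => (K, set_reg r (cell s (reg s a)) s)
  | Write a r => (K, set_mem (reg s a) (reg s r) s)
  | Flip r =>
      (K, set_reg r (head false (coins s))
            (State (reg s) (cell s) (behead (coins s))))
  | Seq c1 c2 => ([:: c1, c2 & K], s)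
  | If r c1 c2 => ((if reg s r != 0 then c1 else c2) :: K, s)
  | While r c1 => (if reg s r != 0 then [:: c1, c & K] else K, s)
  end.

(* c times the bit length of n, for words of O(log n) bits. *)
Definition word_size (c n : nat) : nat := c * (trunc_log 2 n).+1.

(* The input (G, k): the number of vertices of G in register 0, k in register 1,
   and the adjacency matrix of G, row by row, in memory from address 0 on; all the
   other registers and cells are 0. *)
Definition input_reg (G : graph) (k r : nat) : nat :=
  match r with 0 => nverts G | 1 => k | _ => 0 end.

Definition input_mem (G : graph) (a : nat) : nat :=
  [exists i : 'I_(nverts G), exists j : 'I_(nverts G),
    (a == i * nverts G + j) && adj i j].

Definition init (P : cmd) (G : graph) (k : nat) (tape : seq bool) : config :=
  ([:: P], State (input_reg G k) (input_mem G) tape).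

(* [cf] is halted with output [H]: its number of vertices is in register 0, and the
   adjacency matrix is stored, row by row, in addressable memory from the
   address in register 1 on. *)
Definition halted_with (w : nat) (cf : config) (H : graph) : Prop :=
  let: (stack, s) := cf in
  [/\ stack = [::],
      reg s 0 = nverts H,
      reg s 1 + nverts H ^ 2 <= 2 ^ w &
      forall i j : 'I_(nverts H),
        cell s (reg s 1 + (i * nverts H + j)) = adj i j].

(* [P], with words of [word_size c n] bits for n the number of vertices of [G],
   halts on the input (G, k) and the given random tape within T steps, with output
   [H]; [step] leaves halted configurations unchanged. *)
Definition computes_within (P : cmd) (c T : nat) (G : graph) (k : nat)
    (tape : seq bool) (H : graph) : Prop :=
  let w := word_size c (nverts G) in
  halted_with w (iter T (step w) (init P G k tape)) H.

Definition uniform_prob (R : realType) (Omega : finType) (E : pred Omega) : R :=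
  (#|E|%:R / #|Omega|%:R)%R.

(* Main.v *)
Require Import Defs.
From mathcomp Require Import all_boot all_order all_algebra.
From mathcomp Require Import reals exp.
From mathcomp Require Import zify ring lra.

Set Implicit Arguments.
Unset Strict Implicit.
Unset Printing Implicit Defensive.

Import Order.TTheory GRing.Theory Num.Theory.

(* Draw a random bipartite graph T between the n vertices of G and N columns,
   with edge probability 2^-t. The vertices of G' are the n^2 pairs (u, v) and the
   N columns; the pair (u, v) is joined to the column b when u = v or uv is an edge
   of G, and T joins both u and v to b. A set of k^2 pairs has at least k endpoints,
   and exactly k only if these endpoints form a clique of G and all ordered pairs
   of them are taken. For t about (2 log n) / k and N about k^4 n^2, each of
   the following holds with probability at least 9/10:
   - no k + 1 vertices have k^2 common neighbours (union bound), so a K_{k^2,k^2}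
     in G' yields a clique of G;
   - k vertices fixed in advance have k^2 common neighbours: cut the columns into
     k^2 blocks and find one in each block. *)

Local Open Scope nat_scope.

(** * Execution of structured commands *)

(** Quantifying over the stack [K] lets runs be chained under any continuation. [T] is only an upper
    bound, since the branches of a conditional may differ in cost. *)
Definition exec (w : nat) (c : cmd) (s s' : state) (T : nat) : Prop :=
  exists2 T', T' <= T & forall K, iter T' (step w) (c :: K, s) = (K, s').

Lemma exec_seq w c1 c2 s1 s2 s3 T1 T2 T :
  exec w c1 s1 s2 T1 -> exec w c2 s2 s3 T2 -> (T1 + T2).+1 <= T ->
  exec w (Seq c1 c2) s1 s3 T.
Proof.
move=> [t1 le1 run1] [t2 le2 run2] leT.
exists (t2 + t1).+1; first by lia.
by move=> K; rewrite iterSr /= iterD run1 run2.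
Qed.

(** The invariant is indexed by the number of completed iterations. Each iteration pays one extra
    step for its test, and the final failing test makes the bound on [T] strict. *)
Lemma exec_while w r c (Inv : nat -> state -> Prop) m Tb T s :
  (forall i s, i < m -> Inv i s ->
     reg s r != 0 /\ exists2 s', Inv i.+1 s' & exec w c s s' Tb) ->
  (forall s, Inv m s -> reg s r = 0) ->
  m * Tb.+1 < T -> Inv 0 s ->
  exists2 s', Inv m s' & exec w (While r c) s s' T.
Proof.
move=> Hstep Hend leT Inv0.
suff H d i s1 : i + d = m -> Inv i s1 ->
    exists2 s', Inv m s' & exec w (While r c) s1 s' (d * Tb.+1).+1.
  have [s' Is' [t let_ run]] := H m 0 s (add0n m) Inv0.
  by exists s' => //; exists t => //; lia.
elim: d i s1 => [|d IHd] i s1 Em Is1.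
  rewrite addn0 in Em; rewrite Em in Is1.
  exists s1 => //; exists 1 => // K.
  by rewrite /= (Hend _ Is1).
have [|r0 [s2 Is2 [t1 le1 run1]]] := Hstep i s1 _ Is1; first by lia.
have [|s3 Is3 [t2 le2 run2]] := IHd i.+1 s2 _ Is2; first by lia.
exists s3 => //; exists (t2 + t1).+1; first by lia.
by move=> K; rewrite iterSr iterD /= r0 run1 run2.
Qed.

Fixpoint loopfree (c : cmd) : bool :=
  match c with
  | Seq c1 c2 | If _ c1 c2 => loopfree c1 && loopfree c2
  | While _ _ => false
  | _ => true
  end.

Fixpoint cost (c : cmd) : nat :=
  match c with
  | Seq c1 c2 => (cost c1 + cost c2).+1
  | If _ c1 c2 => (maxn (cost c1) (cost c2)).+1
  | _ => 1
  end.

(** A functional semantics for loop-free code, so that such code can be evaluated by rewriting. On a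
    [While] it performs a single step and does not give the meaning of the loop. *)
Fixpoint run (w : nat) (c : cmd) (s : state) : state :=
  match c with
  | Seq c1 c2 => run w c2 (run w c1 s)
  | If r c1 c2 => if reg s r != 0 then run w c1 s else run w c2 s
  | _ => (step w ([:: c], s)).2
  end.

Lemma exec_run w c s : loopfree c -> exec w c s (run w c s) (cost c).
Proof.
elim: c s => //=; try by move=> *; exists 1.
  move=> c1 IH1 c2 IH2 s /andP[/IH1{}IH1 /IH2{}IH2].
  exact: exec_seq (IH1 _) (IH2 _) _.
move=> r c1 IH1 c2 IH2 s /andP[/IH1{}IH1 /IH2{}IH2].
case: ifP => r0.
  have [t let_ Ht] := IH1 s; exists t.+1; first by rewrite ltnS (leq_trans let_) ?leq_maxl.
  by move=> K; rewrite iterSr /= r0 Ht.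
have [t let_ Ht] := IH2 s; exists t.+1; first by rewrite ltnS (leq_trans let_) ?leq_maxr.
by move=> K; rewrite iterSr /= r0 Ht.
Qed.

Lemma exec_halted w c s s' T : exec w c s s' T ->
  iter T (step w) ([:: c], s) = ([::], s').
Proof.
move=> [t let_ Ht]; rewrite -(subnK let_) iterD Ht.
by elim: (T - t) => //= d ->.
Qed.

(** * The reduction as a RAM program *)

(** Absence of overflow becomes a side condition, and the register receives the intended value [v]
    in a chosen form. *)
Lemma run_binop v w o r a b s :
  eval_binop o (reg s a) (reg s b) = v -> v < 2 ^ w ->
  run w (Binop o r a b) s = set_reg r v s.
Proof. by move=> /= -> /modn_small ->. Qed.

Lemma run_const w r v s : v < 2 ^ w -> run w (Const r v) s = set_reg r v s.
Proof. by move=> /= /modn_small ->. Qed.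

Lemma run_seq w c1 c2 s : run w (Seq c1 c2) s = run w c2 (run w c1 s).
Proof. by []. Qed.

Lemma run_if w r c1 c2 s :
  run w (If r c1 c2) s = if reg s r != 0 then run w c1 s else run w c2 s.
Proof. by []. Qed.

Lemma run_skip w s : run w Skip s = s.
Proof. by []. Qed.

Lemma run_read w r a s : run w (Read r a) s = set_reg r (cell s (reg s a)) s.
Proof. by []. Qed.

Lemma run_write w a r s : run w (Write a r) s = set_mem (reg s a) (reg s r) s.
Proof. by []. Qed.

Lemma run_flip w r s : run w (Flip r) s =
  set_reg r (head false (coins s)) (State (reg s) (cell s) (behead (coins s))).
Proof. by []. Qed.

Arguments run : simpl never.

Notation "c1 ;; c2" := (Seq c1 c2) (at level 90, right associativity).

(* The t coins of the vertex u and the column b are those at the positions p with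
   p %/ t = u * N + b, and T joins u to b when all of them are false; [hit] looks
   for a true one among the first q coins of the tape. *)
Definition hit (tape : seq bool) (t q g : nat) : bool :=
  has (fun p => (p %/ t == g) && nth false tape p) (iota 0 q).

(** The common end of the counted loops: [While] only tests for nonzero, so the guard in register 10
    is the number of iterations left. *)
Definition tail : cmd := Binop AddOp 9 9 2 ;; Binop SubOp 10 8 9.

Lemma run_tail w M i s : reg s 2 = 1 -> reg s 8 = M -> reg s 9 = i ->
  i < M -> M < 2 ^ w -> run w tail s = set_reg 10 (M - i.+1) (set_reg 9 i.+1 s).
Proof.
move=> S2 S8 S9 lti ltM.
rewrite /tail run_seq (run_binop (v := i.+1) _ (s := s)); last by lia.
  by rewrite (run_binop (v := M - i.+1)) //=; [rewrite S8|lia].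
by rewrite /= S9 S2 addn1.
Qed.

(* Registers: 0 = n, 2 = 1, 3 = n^2, 5 = t, 6 = N, 7 = n^2 + N, 8 = number of
   iterations, 9 = loop index, 10 = iterations left, 12 = output address. Memory:
   adjacency matrix of G in the first n^2 cells, [hit] table in the next n * N
   cells, then the output matrix. *)
Definition flip_body : cmd :=
  Flip 11 ;; Binop DivOp 13 9 5 ;; Binop AddOp 13 3 13 ;;
  If 11 (Write 13 2) Skip ;; tail.

(* The second line sorts the endpoints x and y of the current entry of the output
   matrix into registers 13 and 14, as y - (y - x) and x + (y - x) with truncated
   subtraction; registers 17 and 18 are nonzero when these are a pair and a column
   respectively. *)
Definition out_body : cmd :=
  Binop DivOp 11 9 7 ;; Binop ModOp 13 9 7 ;;
  Binop SubOp 14 13 11 ;; Binop SubOp 13 13 14 ;; Binop AddOp 14 11 14 ;;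
  Binop DivOp 15 13 0 ;; Binop ModOp 16 13 0 ;;
  Binop SubOp 17 3 13 ;;
  Binop AddOp 18 14 2 ;; Binop SubOp 18 18 3 ;;
  Binop SubOp 14 14 3 ;;
  Read 13 13 ;;
  Binop SubOp 19 15 16 ;; Binop SubOp 20 16 15 ;; Binop AddOp 19 19 20 ;;
  Binop MulOp 15 15 6 ;; Binop AddOp 15 15 14 ;; Binop AddOp 15 3 15 ;; Read 15 15 ;;
  Binop MulOp 16 16 6 ;; Binop AddOp 16 16 14 ;; Binop AddOp 16 3 16 ;; Read 16 16 ;;
  Const 20 0 ;;
  If 17 (If 18 (If 15 Skip (If 16 Skip
    (If 19 (If 13 (Const 20 1) Skip) (Const 20 1)))) Skip) Skip ;;
  Binop AddOp 18 12 9 ;; Write 18 20 ;; tail.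

Lemma mulD_lt z b n N : z < n -> b < N -> z * N + b < n * N.
Proof.
move=> ltz ltb; rewrite -addnS (leq_trans (leq_add (leqnn _) ltb)) //.
by rewrite -mulSnr leq_mul2r ltz orbT.
Qed.

Lemma nverts_ge3 n N : 0 < n -> 1 < N -> 2 < n * n + N.
Proof.
move=> n0 N1; have : 0 < n * n by rewrite muln_gt0 n0.
by lia.
Qed.

(** With [flips_le], this reduces the absence of overflow to one bound on the cube of V = n^2 + N:
    here n^2 <= V, n N <= V^2 and V >= 3. *)
Lemma output_le n N : 0 < n -> 1 < N ->
  n * n + n * N + (n * n + N) * (n * n + N) <= (n * n + N) * (n * n + N) * (n * n + N).
Proof.
move=> n0 N1; have V3 := nverts_ge3 n0 N1; set V := n * n + N in V3 *.
have leV : n * n <= V by rewrite leq_addr.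
have leN : n * N <= V * V by apply: leq_mul; rewrite ?leq_addl //; move: leV; nia.
have : 3 * (V * V) <= V * V * V by rewrite mulnC; apply: leq_mul V3.
have : V <= V * V by rewrite leq_pmulr //; lia.
by move: (V * V * V) (V * V) (n * N) (n * n) leV leN; lia.
Qed.

Lemma flips_le n N t : 0 < n -> t <= N ->
  n * N * t <= (n * n + N) * (n * n + N) * (n * n + N).
Proof.
move=> n0 leN; have len : n <= n * n by rewrite leq_pmulr.
by do 2?[apply: leq_mul]; lia.
Qed.

(** * Invariants of the coin-flipping loop and of the output loop *)

Section Loops.
Variables (w n N t : nat) (tape : seq bool) (gm : nat -> nat).
Let V := n * n + N.
Let m := n * N * t.
Let base := n * n + n * N.
Hypotheses (n_gt0 : 0 < n) (N_gt1 : 1 < N) (t_leN : t <= N) (Vw : V * V * V < 2 ^ w).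

Definition params (s : state) : Prop :=
  [/\ reg s 0 = n, reg s 2 = 1, reg s 3 = n * n & reg s 5 = t] /\
  [/\ reg s 6 = N, reg s 7 = V & reg s 12 = base].

Definition loaded (q : nat) (mem : nat -> nat) : Prop :=
  (forall a, a < n * n -> mem a = gm a) /\
  (forall g, g < n * N -> mem (n * n + g) = hit tape t q g).

Definition flip_inv (q : nat) (s : state) : Prop :=
  [/\ params s, reg s 8 = m, reg s 9 = q, reg s 10 = m - q &
      coins s = drop q tape /\ loaded q (cell s)].

Lemma hitS q g :
  hit tape t q.+1 g = hit tape t q g || (q %/ t == g) && nth false tape q.
Proof. by rewrite /hit -addn1 iotaD has_cat /= orbF. Qed.

(** The program reads the [hit] table before testing that its arguments are a pair and a column, so
    the address must fit in a word for arbitrary [z] and [h] below [V]. *)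
Lemma addr_lt z h : z < V -> h < V -> n * n + (z * N + (h - n * n)) < 2 ^ w.
Proof.
have V_ge3 : 3 <= V := nverts_ge3 n_gt0 N_gt1.
move=> ltz lth; apply: leq_ltn_trans Vw.
have leN : z * N <= V * V by apply: leq_mul; [exact: ltnW|rewrite leq_addl].
have H : 3 * (V * V) <= V * V * V by rewrite mulnC; apply: leq_mul V_ge3.
have H2 : 2 * V <= V * V by apply: leq_mul => //; apply: leq_trans V_ge3.
have H3 : n * n <= V by rewrite leq_addr.
by move: (V * V) (V * V * V) (z * N) (n * n) leN H H2 H3 lth; lia.
Qed.

Lemma flip_step q s : q < m -> flip_inv q s ->
  reg s 10 != 0 /\
  exists2 s', flip_inv q.+1 s' & exec w flip_body s s' (cost flip_body).
Proof.
move=> ltq [[[R0 R2 R3 R5] [R6 R7 R12]] R8 R9 R10 [Co [Mg Mt]]].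
have le_m : m <= V * V * V := flips_le n_gt0 t_leN.
have le_b : base + V * V <= V * V * V := output_le n_gt0 N_gt1.
split; first by rewrite R10; lia.
exists (run w flip_body s); last exact: exec_run.
(* For t = 0 the loop has no iteration, so the division by [t] is never by zero. *)
have t_gt0 : 0 < t by move: ltq; rewrite /m; lia.
have lt_g : q %/ t < n * N by rewrite ltn_divLR.
rewrite /flip_body run_seq run_flip.
rewrite run_seq (run_binop (v := q %/ t)) /=; [|by rewrite R9 R5|]; last first.
  by rewrite (leq_ltn_trans (leq_div _ _)) //; lia.
rewrite run_seq (run_binop (v := n * n + q %/ t)) /=; [|by rewrite R3|]; last first.
  by move: le_b; rewrite /base; lia.
have E11 : nat_of_bool (head false (coins s)) = nth false tape q.
  by rewrite Co -nth0 nth_drop addn0.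
have Co' : behead (coins s) = drop q.+1 tape.
  by rewrite Co -drop1 drop_drop add1n.
have fin s2 : params s2 -> reg s2 8 = m -> reg s2 9 = q -> coins s2 = drop q.+1 tape ->
  loaded q.+1 (cell s2) ->
  flip_inv q.+1 (run w tail s2).
  move=> [[S0 S2 S3 S5] [S6 S7 S12]] S8 S9 SC SM.
  by rewrite (run_tail (M := m) (i := q)) //; lia.
rewrite run_seq run_if run_write run_skip /= E11; case: ifPn => Hq; apply: fin => //=.
- split=> [a lta|g ltg] /=.
    by case: eqP => [E|_]; [move: lta; rewrite E ltnNge leq_addr|exact: Mg].
  rewrite R2 (eqn_add2l (n * n)) hitS (Mt _ ltg) [g == _]eq_sym.
  have -> : nth false tape q = true by case: (nth _ _ _) Hq.
  by case: (_ == g); rewrite ?orbT ?orbF.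
split=> // g ltg; rewrite hitS (Mt _ ltg).
by move: Hq; case: (nth _ _ _) => // _; rewrite andbF orbF.
Qed.

(* The pair (u, v) is numbered x = u * n + v, which is also the address of the
   entry (u, v) of the adjacency matrix of G. *)
Definition link (x y : nat) : bool :=
  [&& x < n * n, n * n <= y, (x %/ n == x %% n) || (gm x != 0),
      ~~ hit tape t m (x %/ n * N + (y - n * n)) &
      ~~ hit tape t m (x %% n * N + (y - n * n))].

(** Pairs are numbered before columns, so sorting the endpoints puts the pair first, as [link]
    expects. *)
Definition out_bit (p : nat) : bool :=
  link (minn (p %/ V) (p %% V)) (maxn (p %/ V) (p %% V)).

Definition out_inv (p : nat) (s : state) : Prop :=
  [/\ params s, reg s 8 = V * V, reg s 9 = p, reg s 10 = V * V - p &
      loaded m (cell s) /\ forall p', p' < p -> cell s (base + p') = out_bit p'].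

Lemma out_step p s : p < V * V -> out_inv p s ->
  reg s 10 != 0 /\
  exists2 s', out_inv p.+1 s' & exec w out_body s s' (cost out_body).
Proof.
move=> ltp [[[R0 R2 R3 R5] [R6 R7 R12]] R8 R9 R10 [[Mg Mt] Mo]].
have le_b : base + V * V <= V * V * V := output_le n_gt0 N_gt1.
have V3 : 3 <= V := nverts_ge3 n_gt0 N_gt1.
split; first by rewrite R10; lia.
exists (run w out_body s); last exact: exec_run.
have ltx : p %/ V < V by rewrite ltn_divLR //; lia.
have lty : p %% V < V by rewrite ltn_mod; lia.
set x := p %/ V in ltx *; set y := p %% V in lty *.
have VV : V < V * V * V by apply: leq_ltn_trans (_ : V * V < _); nia.
rewrite /out_body.
rewrite run_seq (run_binop (v := x) _ (s := s)) /=; [|by rewrite R9 R7|lia].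
rewrite run_seq (run_binop (v := y)) /=; [|by rewrite R9 R7|lia].
rewrite run_seq (run_binop (v := y - x)) //=; [|lia].
set lo := minn x y; set hi := maxn x y.
rewrite run_seq (run_binop (v := lo)) /=; [|rewrite /lo; lia|rewrite /lo; lia].
rewrite run_seq (run_binop (v := hi)) /=; [|rewrite /hi; lia|rewrite /hi; lia].
have lo_lt : lo < V by rewrite /lo; lia.
have hi_lt : hi < V by rewrite /hi; lia.
have u_lt : lo %/ n < V by apply: leq_ltn_trans (leq_div _ _) _.
have v_lt : lo %% n < V by apply: leq_ltn_trans (leq_mod _ _) _.
rewrite run_seq (run_binop (v := lo %/ n)) /=; [|by rewrite R0|lia].
rewrite run_seq (run_binop (v := lo %% n)) /=; [|by rewrite R0|lia].
rewrite run_seq (run_binop (v := n * n - lo)) /=; [|by rewrite R3|rewrite /V in VV; lia].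
rewrite run_seq (run_binop (v := hi.+1)) /=; [|by rewrite R2 addn1|lia].
rewrite run_seq (run_binop (v := hi.+1 - n * n)) /=; [|by rewrite R3|lia].
rewrite run_seq (run_binop (v := hi - n * n)) /=; [|by rewrite R3|lia].
rewrite run_seq run_read /=.
set u := lo %/ n in u_lt *; set v := lo %% n in v_lt *.
rewrite run_seq (run_binop (v := u - v)) //=; [|lia].
rewrite run_seq (run_binop (v := v - u)) //=; [|lia].
rewrite run_seq (run_binop (v := (u - v) + (v - u))) //=; [|lia].
have zu := addr_lt u_lt hi_lt; have zv := addr_lt v_lt hi_lt.
rewrite run_seq (run_binop (v := u * N)) /=; [|by rewrite R6|lia].
rewrite run_seq (run_binop (v := u * N + (hi - n * n))) //=; [|lia].
rewrite run_seq (run_binop (v := n * n + (u * N + (hi - n * n)))) //=; [|by rewrite R3].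
rewrite run_seq run_read /=.
rewrite run_seq (run_binop (v := v * N)) /=; [|by rewrite R6|lia].
rewrite run_seq (run_binop (v := v * N + (hi - n * n))) //=; [|lia].
rewrite run_seq (run_binop (v := n * n + (v * N + (hi - n * n)))) //=; [|by rewrite R3].
rewrite run_seq run_read /= run_seq run_const; last by lia.
rewrite run_seq.
set s2 := set_reg 20 0 _.
have fin (s3 : state) : params s3 -> reg s3 8 = V * V -> reg s3 9 = p -> cell s3 = cell s ->
    reg s3 20 = out_bit p ->
    out_inv p.+1 (run w (Binop AddOp 18 12 9 ;; Write 18 20 ;; tail) s3).
  move=> P3 S8 S9 SC S20; have [[S0 S2 S3 S5] [S6 S7 S12]] := P3.
  rewrite run_seq (run_binop (v := base + p) _ (s := s3)) /=; [|by rewrite S12 S9|lia].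
  rewrite run_seq run_write /= S20.
  rewrite (run_tail (M := V * V) (i := p)) //; [|lia].
  split=> //; rewrite /= SC; split.
    (* The write at [base + p] lies beyond both the adjacency matrix and the [hit] table. *)
    split=> [a lta|g ltg] /=.
      by case: eqP => [E|_]; [move: lta; rewrite E /base; lia|exact: Mg].
    by case: eqP => [E|_]; [move: ltg E; rewrite /base; lia|exact: Mt].
  move=> p' ltp' /=; rewrite (eqn_add2l base).
  by case: eqP => [->//|ne]; apply: Mo; lia.
have w0 : 1 < 2 ^ w by lia.
have glt z : z < n -> n * n <= hi -> z * N + (hi - n * n) < n * N.
  by move=> ltz leh; apply: mulD_lt => //; move: hi_lt; rewrite /V; lia.
(* The cells read are meaningful only if [lo] is a pair and [hi] a column; otherwise one of the
   first two conjuncts makes both sides false. *)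
have ob : out_bit p = [&& n * n - lo != 0, hi.+1 - n * n != 0,
     cell s (n * n + (u * N + (hi - n * n))) == 0, cell s (n * n + (v * N + (hi - n * n))) == 0
   & ((u - v) + (v - u) == 0) || (cell s lo != 0)].
  rewrite /out_bit -/x -/y -/lo -/hi /link -/u -/v !subn_eq0 -!ltnNge ltnS.
  case: ltnP => // ltlo; case: leqP => //= lehi.
  have ltu : u < n by rewrite ltn_divLR.
  have ltv : v < n by rewrite ltn_mod.
  rewrite (Mg lo) // !Mt ?glt // andbC -!andbA !eqb0.
  by congr [&& _, _ & (_ || _)]; lia.
have -> : run w (If 17 (If 18 (If 15 Skip (If 16 Skip
    (If 19 (If 13 (Const 20 1) Skip) (Const 20 1)))) Skip) Skip) s2 =
    if out_bit p then set_reg 20 1 s2 else s2.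
  rewrite ob !run_if !run_skip !run_const //.
  have [-> [-> [-> [-> [-> ->]]]]] : reg s2 17 = n * n - lo /\ reg s2 18 = hi.+1 - n * n /\
     reg s2 15 = cell s (n * n + (u * N + (hi - n * n))) /\
     reg s2 16 = cell s (n * n + (v * N + (hi - n * n))) /\
     reg s2 19 = u - v + (v - u) /\ reg s2 13 = cell s lo by [].
  by clear; move: (set_reg 20 1 s2) => s3; move: s2 => s2; do 6!case: (_ == 0).
by case: ifP => Hb; apply: fin => //=; rewrite Hb.
Qed.
End Loops.

(* N is k^2 blocks of 16 k^2 2^L columns, where 2^L >= 2^(k t) is at least the
   inverse of the probability that k given vertices are all joined to a column. *)
Definition levels (n : nat) : nat := up_log 2 (n * n).
Definition depth (n k : nat) : nat := levels n %/ k.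
Definition cols (n k : nat) : nat := 16 * (k * k * (k * k)) * 2 ^ levels n.

Lemma cols_ge n k : 0 < k -> 16 * 2 ^ levels n <= cols n k.
Proof.
by move=> k_gt0; rewrite leq_mul2r; apply/orP; right; rewrite leq_pmulr // !muln_gt0 k_gt0.
Qed.

Lemma cols_gt1 n k : 0 < k -> 1 < cols n k.
Proof.
move=> /(cols_ge n); apply: leq_trans; have : 0 < 2 ^ levels n by rewrite expn_gt0.
by lia.
Qed.

Lemma depth_le_cols n k : 0 < k -> depth n k <= cols n k.
Proof.
move=> /(cols_ge n); apply: leq_trans; apply: leq_trans (leq_div _ _) _.
by rewrite ltnW // (leq_trans (ltn_expl _ (ltnSn 1))) // leq_pmull.
Qed.

(** Computes [levels] by doubling: the truncated guard n^2 - 2^i vanishes at the first i with n^2 <=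
    2^i. *)
Definition log_body : cmd :=
  Binop AddOp 4 4 4 ;; Binop AddOp 5 5 2 ;; Binop SubOp 10 3 4.

Definition setup : cmd :=
  Const 2 1 ;; Binop MulOp 3 0 0 ;; Const 4 1 ;; Binop SubOp 10 3 4.

Definition parameters : cmd :=
  Binop MulOp 11 1 1 ;; Binop MulOp 11 11 11 ;;
  Const 6 16 ;; Binop MulOp 6 6 11 ;; Binop MulOp 6 6 4 ;;
  Binop DivOp 5 5 1 ;; Binop AddOp 7 3 6 ;;
  Binop MulOp 8 0 6 ;; Binop AddOp 12 3 8 ;; Binop MulOp 8 8 5 ;;
  Binop SubOp 10 8 9.

Definition rewind : cmd :=
  Binop MulOp 8 7 7 ;; Const 9 0 ;; Binop SubOp 10 8 9.

Definition result : cmd :=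
  Const 11 0 ;; Binop AddOp 0 7 11 ;; Binop AddOp 1 12 11.

Definition reduction_cmd : cmd :=
  setup ;; While 10 log_body ;; parameters ;; While 10 flip_body ;;
  rewind ;; While 10 out_body ;; result.

(** * Correctness and step count of the whole program *)

Section Program.
Variables (w n k : nat) (tape : seq bool) (gm : nat -> nat).
Let L := levels n.
Let t := depth n k.
Let N := cols n k.
Let V := n * n + N.
Let m := n * N * t.
Hypotheses (nverts_gt1 : 1 < n) (k_gt0 : 0 < k) (Vw : V * V * V < 2 ^ w).
Hypothesis gm0 : forall a, n * n <= a -> gm a = 0.

Definition log_inv (i : nat) (s : state) : Prop :=
  [/\ reg s 0 = n, reg s 1 = k, reg s 2 = 1 & reg s 3 = n * n] /\
  [/\ reg s 4 = 2 ^ i, reg s 5 = i, reg s 9 = 0 & reg s 10 = n * n - 2 ^ i] /\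
  coins s = tape /\ cell s = gm.

Let N_ge : 16 * 2 ^ L <= N := cols_ge n k_gt0.
Let N_gt1 : 1 < N := cols_gt1 n k_gt0.
Let t_leN : t <= N := depth_le_cols n k_gt0.

Lemma V_lt : 3 * V < 2 ^ w.
Proof.
apply: leq_ltn_trans Vw; rewrite leq_mul2r; apply/orP; right.
have V3 : 3 <= V by have := N_gt1; rewrite /V; lia.
by apply: leq_trans V3 _; rewrite leq_pmulr //; lia.
Qed.

Lemma log_step i s : i < L -> log_inv i s ->
  reg s 10 != 0 /\
  exists2 s', log_inv i.+1 s' & exec w log_body s s' (cost log_body).
Proof.
move=> ltiL [[R0 R1 R2 R3] [[R4 R5 R9 R10] [Co Ce]]].
have ltn2 : 2 ^ i < n * n.
  by rewrite ltnNge; apply/negP => /up_log_min -/(_ isT); rewrite leqNgt ltiL.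
have le2 : 2 ^ i.+1 <= 2 ^ L by rewrite leq_exp2l.
have N1 := N_ge; have V1 := V_lt; have ltL : L < 2 ^ L by rewrite ltn_expl.
split; first by rewrite R10; lia.
exists (run w log_body s); last exact: exec_run.
rewrite /log_body run_seq (run_binop (v := 2 ^ i.+1)) /=; last first.
- by move: V1; rewrite /V; lia.
- by rewrite R4 expnS; lia.
rewrite run_seq (run_binop (v := i.+1) _ (s := set_reg _ _ _)) /=; last first.
- by move: V1; rewrite /V; lia.
- by rewrite R5 R2 addn1.
rewrite (run_binop (v := n * n - 2 ^ i.+1)) /=; last first.
- by move: V1; rewrite /V; lia.
- by rewrite R3.
by [].
Qed.

(** The final 9 counts six sequencing steps and three failing loop tests. *)
Definition steps : nat :=
  cost setup + L * (cost log_body).+1 + cost parameters +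
  m * (cost flip_body).+1 + cost rewind + V * V * (cost out_body).+1 +
  cost result + 9.

Lemma exec_reduction s0 : reg s0 0 = n -> reg s0 1 = k ->
  reg s0 5 = 0 -> reg s0 9 = 0 -> cell s0 = gm -> coins s0 = tape ->
  exists2 s, [/\ reg s 0 = V, reg s 1 = n * n + n * N &
     forall p, p < V * V -> cell s (n * n + n * N + p) = out_bit n N t tape gm p]
   & exec w reduction_cmd s0 s steps.
Proof.
move=> A0 A1 A5 A9 Ce Co.
have N1 := N_ge; have V1 := V_lt; have N2 := N_gt1; have tN := t_leN.
have n_gt0 : 0 < n by lia.
have nnV : n * n < V by rewrite /V; lia.
have lenn : n <= n * n by rewrite leq_pmulr.
have b_le : n * n + n * N + V * V < 2 ^ w by apply: leq_ltn_trans Vw; exact: output_le.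
have m_le : m < 2 ^ w by apply: leq_ltn_trans Vw; exact: flips_le.
have I1 : log_inv 0 (run w setup s0).
  rewrite /setup run_seq run_const; last by lia.
  rewrite run_seq (run_binop (v := n * n)) /=; [|by rewrite A0|lia].
  rewrite run_seq run_const; last by lia.
  by rewrite (run_binop (v := n * n - 1)) //=; lia.
have [s1 I2 X1] : exists2 s1, log_inv L s1 & exec w (While 10 log_body)
     (run w setup s0) s1 (L * (cost log_body).+1).+1.
  apply: exec_while log_step _ _ I1 => //.
  move=> s [_ [[_ _ _ ->] _]].
  by apply/eqP; rewrite subn_eq0; exact: up_logP.
have I3 : flip_inv n N t tape gm 0 (run w parameters s1).
  have [[R0 R1 R2 R3] [[R4 R5 R9 R10] [Co1 Ce1]]] := I2.
  have expL : 0 < 2 ^ L by rewrite expn_gt0.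
  have k4 : 16 * (k * k * (k * k)) <= N by rewrite /N /cols leq_pmulr // expn_gt0.
  have k2 : k * k <= k * k * (k * k) by rewrite leq_pmulr // muln_gt0 k_gt0.
  have LN : L <= N.
    by apply: leq_trans N1; rewrite ltnW // (leq_trans (ltn_expl _ (ltnSn 1))) // leq_pmull.
  have NV : N <= V by rewrite leq_addl.
  rewrite /parameters.
  rewrite run_seq (run_binop (v := k * k) _ (s := s1)) /=; [|by rewrite R1|lia].
  rewrite run_seq (run_binop (v := k * k * (k * k))) //=; [|lia].
  rewrite run_seq run_const; last by lia.
  rewrite run_seq (run_binop (v := 16 * (k * k * (k * k)))) //=; [|lia].
  rewrite run_seq (run_binop (v := N)) /=; [|by rewrite R4|lia].
  rewrite run_seq (run_binop (v := t)) /=; [|by rewrite R5 R1|lia].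
  rewrite run_seq (run_binop (v := V)) /=; [|by rewrite R3|lia].
  rewrite run_seq (run_binop (v := n * N)) /=; [|by rewrite R0|lia].
  rewrite run_seq (run_binop (v := n * n + n * N)) /=; [|by rewrite R3|lia].
  rewrite run_seq (run_binop (v := m) _ (s := set_reg _ _ _)) //=.
  rewrite (run_binop (v := m - 0)) /=; [|by rewrite R9|lia].
  split=> //=; split; first by rewrite Co1 drop0.
  split=> [a _|g _] /=; first by rewrite Ce1.
  (* Memory is initially zero past the adjacency matrix, which is the correct [hit] table when no
     coin has been read. *)
  by rewrite Ce1 gm0 // leq_addr.
have [s2 I4 X2] : exists2 s2, flip_inv n N t tape gm m s2 &
     exec w (While 10 flip_body) (run w parameters s1) s2 (m * (cost flip_body).+1).+1.
  apply: exec_while _ _ _ I3 => //; first by move=> q s; exact: flip_step.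
  by move=> s [_ _ _ -> _]; rewrite subnn.
have I5 : out_inv n N t tape gm 0 (run w rewind s2).
  have [[[R0 R2 R3 R5] [R6 R7 R12]] R8 R9 R10 [Co1 Ce1]] := I4.
  rewrite /rewind.
  rewrite run_seq (run_binop (v := V * V) _ (s := s2)) /=; [|by rewrite R7|lia].
  rewrite run_seq run_const; last by lia.
  by rewrite (run_binop (v := V * V - 0)) //=; lia.
have [s3 I6 X3] : exists2 s3, out_inv n N t tape gm (V * V) s3 &
     exec w (While 10 out_body) (run w rewind s2) s3 (V * V * (cost out_body).+1).+1.
  apply: exec_while _ _ _ I5 => //; first by move=> q s; exact: out_step.
  by move=> s [_ _ _ -> _]; rewrite subnn.
exists (run w result s3).
  have [[[R0 R2 R3 R5] [R6 R7 R12]] R8 R9 R10 [_ Ce1]] := I6.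
  rewrite /result run_seq run_const; last by lia.
  rewrite run_seq (run_binop (v := V) _ (s := set_reg _ _ _)) /=; [|by rewrite R7 addn0|lia].
  by rewrite R12 addn0 modn_small //; lia.
apply: exec_seq (exec_run _ _ _) (exec_seq X1 (exec_seq (exec_run _ _ _)
  (exec_seq X2 (exec_seq (exec_run _ _ _) (exec_seq X3 (exec_run _ _ _)
  (leqnn _)) (leqnn _)) (leqnn _)) (leqnn _)) (leqnn _)) _ => //.
by rewrite /steps; lia.
Qed.
End Program.

(** * Arithmetic of the parameters *)

Section Bounds.
Variables (n k : nat).
Hypothesis k_ge3 : 2 < k.
Hypothesis n_big : (2 * k ^ (4 * k ^ 2 + k + 3)) ^ ((k + 1) * k ^ 4) < n.
Let L := levels n.
Let t := depth n k.
Let N := cols n k.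
Let V := n * n + N.

Lemma expn_k_le d : d <= (4 * k ^ 2 + k + 3) * ((k + 1) * k ^ 4) -> k ^ d <= n.
Proof.
move=> led; apply: leq_trans (ltnW n_big).
have k_gt0 : 0 < k by lia.
apply: (@leq_trans ((k ^ (4 * k ^ 2 + k + 3)) ^ ((k + 1) * k ^ 4))).
  by rewrite -expnM leq_pexp2l.
have [->|d0] := posnP ((k + 1) * k ^ 4); first by rewrite !expn0.
by rewrite leq_exp2r // leq_pmull.
Qed.

(** Collects what the union bound must absorb: the factor 10 for the probability, the constant 16
    k^4 of [cols] to the power k^2, and the loss from rounding [depth] down. *)
Lemma slack_le : 10 * (16 * (k * k * (k * k))) ^ (k ^ 2) * 2 ^ (k ^ 2 * (k + 1)) <= n.
Proof.
have k_gt0 : 0 < k by lia.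
(* Since k >= 3, 10 and 16 are at most k^3, hence 16 k^4 <= k^7, and 2 <= k. *)
apply: (@leq_trans (k ^ (3 + 7 * k ^ 2 + k ^ 2 * (k + 1)))).
  rewrite (expnD k (3 + _)) (expnD k 3) (expnM k 7).
  apply: leq_mul; last by rewrite leq_exp2r ?expn_gt0 ?k_gt0 //; lia.
  apply: leq_mul; first by rewrite !expnS expn0; nia.
  rewrite leq_exp2r ?expn_gt0 ?k_gt0 // -[7]/(3 + 4) (expnD k 3 4).
  apply: leq_mul; first by rewrite !expnS expn0; nia.
  by rewrite !expnS expn0 muln1 !mulnA.
apply: expn_k_le.
have k2 : 9 <= k ^ 2 by rewrite (@leq_exp2r 3 k 2).
have -> : k ^ 4 = k ^ 2 * k ^ 2 by rewrite -expnD.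
move: (k ^ 2) k2 => K K9.
have : 81 * (4 * K * (k + 1)) <= K * K * (4 * K * (k + 1)) by apply: leq_mul => //; nia.
have : K * K * (4 * K * (k + 1)) <= (4 * K + k + 3) * ((k + 1) * (K * K)).
  rewrite mulnC -mulnA; apply: leq_mul; [lia|].
  by rewrite mulnC.
nia.
Qed.

(** Here 33 = 1 + 16 * 2: as 2^L <= 2 n^2, the output graph has at most n^2 + 32 k^4 n^2 <= 33 k^4
    n^2 vertices, so at most n^3. *)
Lemma quartic_le : 33 * (k * k * (k * k)) <= n.
Proof.
apply: (@leq_trans (k ^ (4 + 4))).
  rewrite expnD; apply: leq_mul; last by rewrite !expnS expn0 muln1 !mulnA.
  by apply: leq_trans (_ : 3 ^ 4 <= _); rewrite ?leq_exp2r.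
apply: expn_k_le; have : 1 <= (k + 1) * k ^ 4 by rewrite muln_gt0 addn1 expn_gt0 /=; lia.
have : 9 <= k ^ 2 by rewrite (@leq_exp2r 3 k 2).
by nia.
Qed.

Lemma nverts_gt1 : 1 < n.
Proof. by apply: leq_trans quartic_le; nia. Qed.

Lemma expn_levels_ge : n * n <= 2 ^ L.
Proof. exact: up_logP. Qed.

Lemma expn_levels_lt : 2 ^ L.-1 < n * n.
Proof.
by apply: up_log_gtn => //; apply: leq_trans nverts_gt1 _; rewrite leq_pmulr // ltnW ?nverts_gt1.
Qed.

Lemma levels_gt0 : 0 < L.
Proof. by rewrite up_log_gt0 //= (leq_trans nverts_gt1) // leq_pmulr // ltnW ?nverts_gt1. Qed.

Lemma levels_le : L <= n * n.
Proof.
rewrite -(prednK levels_gt0); apply: leq_trans expn_levels_lt.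
by rewrite ltnS ltnW // ltn_expl.
Qed.

Lemma out_nverts_le : V <= n ^ 3.
Proof.
have leL : 2 ^ L <= 2 * (n * n).
  by rewrite -(prednK levels_gt0) expnS leq_mul2l /= ltnW // expn_levels_lt.
have -> : n ^ 3 = n * (n * n) by rewrite !expnS expn0 muln1.
apply: leq_trans (leq_mul quartic_le (leqnn (n * n))).
rewrite /V /N /cols -/L; move: (n * n) leL => m leL.
have : 0 < k * k * (k * k) by rewrite !muln_gt0; lia.
move: (k * k * (k * k)) => a a_gt0.
have : 16 * a * 2 ^ L <= 16 * a * (2 * m) by rewrite leq_mul2l leL orbT.
by nia.
Qed.

Lemma cols_le : N <= n ^ 3.
Proof. by apply: leq_trans out_nverts_le; rewrite leq_addl. Qed.

(** With [out_matrix_le], the source of the exponent 6: there are at most n * n^3 * n^2 flips, and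
    at most (n^3)^2 output entries. *)
Lemma coins_le : n * N * t <= n ^ 6.
Proof.
have -> : n ^ 6 = n * n ^ 3 * (n * n) by rewrite !expnS expn0; lia.
apply: leq_mul; first by rewrite leq_mul2l cols_le orbT.
by apply: leq_trans levels_le; exact: leq_div.
Qed.

Lemma out_matrix_le : V * V <= n ^ 6.
Proof. by rewrite -[6]/(3 + 3) expnD leq_mul // out_nverts_le. Qed.

(** The word factor 9 arises from V^3 <= (n^3)^3 and from n being below 2 to its bit length. *)
Lemma out_nverts3_lt_word : V * V * V < 2 ^ word_size 9 n.
Proof.
apply: (@leq_ltn_trans (n ^ 9)).
  by rewrite -[9]/(6 + 3) expnD leq_mul ?out_nverts_le ?out_matrix_le.
by rewrite /word_size mulnC expnM ltn_exp2r // trunc_log_ltn.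
Qed.

Lemma depth_mul_le : k * t <= L.
Proof. by rewrite mulnC leq_divM. Qed.

(** Rounding gives L <= k t + k. After multiplication by 2^(k^2 (k+1)) the right side is thus at
    least 2^(L k^2 + L k). The factor 2^(L k^2) cancels against N^(k^2), and 2^(L k) >= n^(2k)
    dominates the remaining n^(k+2), which includes one factor n for the slack. *)
Lemma blocks_small :
  10 * (n ^ k.+1 * N ^ (k ^ 2)) <= 2 ^ (k.+1 * k ^ 2 * t).
Proof.
have k_gt0 : 0 < k by lia.
have ltL : L <= k * t + k by rewrite addnC -mulnS mulnC ltnW // ltn_ceil.
have p2 : 0 < 2 ^ (k ^ 2 * (k + 1)) by rewrite expn_gt0.
rewrite -(leq_pmul2r p2) -expnD.
apply: (@leq_trans (2 ^ (L * k ^ 2 + L * k))); last first.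
  rewrite leq_exp2l //; apply: (@leq_trans ((k * t + k) * (k ^ 2 + k))).
    by rewrite -mulnDr leq_mul2r ltL orbT.
  by rewrite -mulnn; nia.
rewrite expnD [2 ^ (L * k)]expnM [2 ^ (L * k ^ 2)]expnM /N /cols -/L expnMn.
set a := (16 * _) ^ _; set b := (2 ^ L) ^ (k ^ 2); set c := 2 ^ _.
have -> : 10 * (n ^ k.+1 * (a * b)) * c = b * (10 * a * c * n ^ k.+1).
  by rewrite -!mulnA; nia.
rewrite leq_mul2l; apply/orP; right.
apply: (@leq_trans (n * n ^ k.+1)); first by rewrite leq_mul2r slack_le orbT.
apply: (@leq_trans ((n * n) ^ k)); last by rewrite leq_exp2r // expn_levels_ge.
rewrite -expnS mulnn -expnM leq_exp2l ?nverts_gt1 //; lia.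
Qed.
End Bounds.

Local Open Scope ring_scope.

(** * Uniform random tapes *)

Section Uniform.
Variables (R : realType) (O : finType).
Hypothesis O_gt0 : (0 < #|O|)%N.
Implicit Types E F : pred O.
Local Notation Pr := (uniform_prob R).

Lemma eq_prob E F : E =1 F -> Pr E = Pr F.
Proof. by move=> eqEF; rewrite /uniform_prob (eq_card (B := F)). Qed.

Lemma le_prob E F : subpred E F -> Pr E <= Pr F.
Proof.
move=> sub; rewrite /uniform_prob ler_wpM2r ?invr_ge0 // ler_nat.
by apply: subset_leq_card; apply/subsetP => x; exact: sub.
Qed.

Lemma prob_predC E : Pr (predC E) = 1 - Pr E.
Proof.
rewrite /uniform_prob -(cardC E) natrD; field.
by rewrite -natrD cardC pnatr_eq0 -lt0n.
Qed.

(** The union bound. *)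
Lemma prob_exists (I : finType) (A : {set I}) (E : I -> pred O) (p : R) :
  (forall i, i \in A -> Pr (E i) <= p) ->
  Pr (fun x => [exists i in A, E i x]) <= #|A|%:R * p.
Proof.
move=> leEp; apply: (@le_trans _ _ (\sum_(i in A) Pr (E i))); last first.
  by apply: (le_trans (ler_sum _ leEp)); rewrite sumr_const mulr_natl.
rewrite /uniform_prob -mulr_suml ler_wpM2r ?invr_ge0 // -natr_sum ler_nat.
have -> : #|fun x => [exists i in A, E i x]| = #|\bigcup_(i in A) [set x | E i x]|.
  apply: eq_card => x; rewrite [LHS]unfold_in.
  apply/exists_inP/bigcupP => -[i Ai]; first by exists i; rewrite ?inE.
  by rewrite inE; exists i.
elim/big_rec2: _ => [|i a B _ le_aB]; first by rewrite cards0.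
by rewrite (leq_trans (leq_card_setU _ _).1) // leq_add // cardsE.
Qed.
End Uniform.

(** * Independence of events on disjoint sets of coins *)

Section Coins.
Variables (R : realType) (len : nat).
Local Notation tape := (len.-tuple bool).
Implicit Types (A B : {set 'I_len}) (E F : pred tape).
Local Notation Pr := (@uniform_prob R tape).

Definition depends A E := forall x y : tape, {in A, tnth x =1 tnth y} -> E x = E y.

Lemma tapes_gt0 : (0 < #|{: tape}|)%N.
Proof. by apply/card_gt0P; exists [tuple false | i < len]. Qed.

Let tapes_neq0 : #|{: tape}|%:R != 0 :> R.
Proof. by rewrite pnatr_eq0 -lt0n tapes_gt0. Qed.

(* Exchanging the coordinates of two tapes off [A] is an involution that maps
   the pairs in [(E /\ F) * tape] onto those in [E * F]. *)
Lemma prob_indep A E F : depends A E -> depends (~: A) F ->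
  Pr (fun x => E x && F x) = Pr E * Pr F.
Proof.
move=> depE depF.
pose mix (x y : tape) : tape := [tuple if i \in A then tnth x i else tnth y i | i < len].
pose swap (z : tape * tape) := (mix z.1 z.2, mix z.2 z.1).
have swapK : involutive swap.
  move=> [x y]; congr (_, _); apply: eq_from_tnth => i; rewrite !tnth_mktuple;
  by case: (i \in A).
have : #|[set z : tape * tape | E z.1 && F z.2]| = (#|[set z : tape * tape | E z.1 && F z.1]|).
  rewrite -(card_preimset _ (inv_inj swapK)).
  apply: eq_card => -[x y]; rewrite !inE /=; congr (_ && _).
    by apply: depE => i Ai; rewrite tnth_mktuple Ai.
  by apply: depF => i; rewrite inE => /negPf nAi; rewrite tnth_mktuple nAi.
have -> : [set z : tape * tape | E z.1 && F z.2] = setX [set x | E x] [set x | F x].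
  by apply/setP => -[x y]; rewrite !inE.
have -> : [set z : tape * tape | E z.1 && F z.1] = setX [set x | E x && F x] setT.
  by apply/setP => -[x y]; rewrite !inE andbT.
rewrite !cardsX cardsT !cardsE => card_eq.
rewrite /uniform_prob mulrACA -invfM -natrM card_eq natrM.
by field.
Qed.

(** The presence of a given set of edges of the random bipartite graph is an event of this form. *)
Definition silent A : pred tape := fun x => [forall i in A, ~~ tnth x i].

Lemma silentP A (x : tape) : reflect (forall i, i \in A -> ~~ tnth x i) (silent A x).
Proof. exact: forall_inP. Qed.

Lemma depends_silent A : depends A (silent A).
Proof.
move=> x y eqxy; apply/silentP/silentP => H i Ai; first by rewrite -eqxy // H.
by rewrite eqxy // H.
Qed.

Lemma depends_sub A B E : A \subset B -> depends A E -> depends B E.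
Proof. by move=> /subsetP sAB dE x y eqxy; apply: dE => i /sAB; exact: eqxy. Qed.

(** Toggling coin [i] is an involution exchanging the event with its complement. *)
Lemma prob_silent1 i : Pr (silent [set i]) = 2^-1.
Proof.
pose flip (x : tape) : tape := [tuple (j == i) (+) tnth x j | j < len].
have flipK : involutive flip.
  by move=> x; apply: eq_from_tnth => j; rewrite !tnth_mktuple addbA addbb.
have H : #|[set x | silent [set i] x]| = #|~: [set x | silent [set i] x]|.
  rewrite -[LHS](card_preimset _ (inv_inj flipK)).
  apply: eq_card => x; rewrite !inE.
  have sE y : silent [set i] y = ~~ tnth y i.
    by apply/silentP/idP => [->|H j]; rewrite ?inE // => /eqP ->.
  by rewrite !sE tnth_mktuple eqxx.
have E : (#|[set x | silent [set i] x]| + #|[set x | silent [set i] x]|)%N = #|{: tape}|.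
  by rewrite {2}H cardsC.
rewrite /uniform_prob -E -cardsE natrD.
have : #|[set x | silent [set i] x]|%:R != 0 :> R.
  by rewrite pnatr_eq0; apply: contraTneq tapes_gt0 => c0; rewrite -E c0.
rewrite (_ : [set x in silent [set i]] = [set x | silent [set i] x]); last first.
  by apply/setP => x; rewrite !inE.
by move: (#|[set x | _]|%:R) => c c0; field; rewrite -mulr2n mulrn_eq0 negb_or c0.
Qed.

Lemma prob_silent A : Pr (silent A) = 2^-1 ^+ #|A|.
Proof.
move: {2}#|A| (erefl #|A|) => d; elim: d A => [|d IHd] A cA; rewrite cA.
  rewrite expr0 /uniform_prob (_ : #|silent A| = #|{: tape}|) ?divff //.
  apply: eq_card => x; rewrite inE; apply/silentP => i.
  by rewrite (cards0_eq cA) inE.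
have [i Ai] : exists i, i \in A by apply/set0Pn; rewrite -card_gt0 cA.
have cA' : #|A :\ i| = d by move: cA; rewrite (cardsD1 i) Ai => -[].
rewrite exprS -{1}cA' -(IHd _ cA') -(prob_silent1 i) -(prob_indep (A := [set i])).
- apply: eq_prob => x; apply/silentP/andP => [H|[/silentP H1 /silentP H2] j Aj].
    split; apply/silentP => j; rewrite !inE; first by move/eqP->; exact: H.
    by case/andP=> _; exact: H.
  have [->|ne] := eqVneq j i; first by apply: H1; rewrite inE.
  by apply: H2; rewrite !inE ne.
- exact: depends_silent.
apply: depends_sub (@depends_silent _).
by apply/subsetP => j; rewrite !inE => /andP[].
Qed.

Lemma prob_forall_indep (I : eqType) (bs : seq I) (D : I -> {set 'I_len})
    (E : I -> pred tape) (p : R) :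
  uniq bs -> (forall b, depends (D b) (E b)) ->
  (forall b c, b != c -> [disjoint D b & D c]) ->
  (forall b, Pr (E b) = p) ->
  Pr (fun x => all (fun b => E b x) bs) = p ^+ size bs.
Proof.
move=> ubs depE disjD prE.
elim: bs ubs => [|b bs IHbs] /=.
  by rewrite expr0 /uniform_prob (_ : #|_| = #|{: tape}|) ?divff //; apply: eq_card.
case/andP=> nb ubs; rewrite exprS -(IHbs ubs) -(prE b).
(* The remaining events read no coin of [D b], so jointly they depend on its complement. *)
apply: (prob_indep (A := D b)) => // x y eqxy.
apply: eq_in_all => c bsc; apply: depE => i Dci; apply: eqxy.
rewrite inE; apply/negP => Dbi.
have /disjD/disjoint_setI0/setP/(_ i) : b != c by apply: contraNneq nb => ->.
by rewrite !inE Dbi Dci.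
Qed.
End Coins.

(** * Random bipartite graphs *)

Lemma bin_leq_expn (n a : nat) : ('C(n, a) <= n ^ a)%N.
Proof.
have : ('C(n, a) <= n ^_ a)%N by rewrite -bin_ffact leq_pmulr // fact_gt0.
move/leq_trans; apply; elim: a n => [|a IH] [|n] //; rewrite ?ffactnS ?expnS ?mul0n //=.
rewrite leq_mul2l /= (leq_trans (IH n)) //.
have [->|a0] := posnP a; first by rewrite !expn0.
by rewrite leq_exp2r ?leqnSn.
Qed.

(** A division-free replacement for the exponential bound on (1 - q)^M. The induction rests on (1 -
    q) (1 + (M + 1) q) <= 1 + M q. *)
Lemma expr1B_mul_le1 (R : realType) (q : R) (M : nat) : 0 <= q <= 1 ->
  (1 - q) ^+ M * (1 + M%:R * q) <= 1.
Proof.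
case/andP=> q0 q1; elim: M => [|M IH]; first by rewrite expr0 mul0r addr0 mul1r.
apply: le_trans IH; rewrite exprSr -mulrA ler_wpM2l ?exprn_ge0 ?subr_ge0 //.
have : 0 <= M%:R * (q * q) by rewrite mulr_ge0 ?mulr_ge0.
by rewrite -natr1; nra.
Qed.

Section Columns.
Variables (R : realType) (n N t len : nat) (pos : 'I_n * 'I_N * 'I_t -> 'I_len).
Hypothesis pos_inj : injective pos.
Local Notation tape := (len.-tuple bool).
Local Notation Pr := (@uniform_prob R tape).

Definition present (x : tape) (u : 'I_n) (b : 'I_N) : bool :=
  [forall j, ~~ tnth x (pos (u, b, j))].

Definition all_present (S : {set 'I_n}) (Q : {set 'I_N}) : pred tape :=
  fun x => [forall u in S, forall b in Q, present x u b].

Let block (S : {set 'I_n}) (Q : {set 'I_N}) := pos @: setX (setX S Q) setT.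

Lemma all_presentE S Q : all_present S Q =1 silent (block S Q).
Proof.
move=> x; apply/forall_inP/silentP => [H i|H u Su].
  case/imsetP=> -[[u b] j]; rewrite !inE andbT => /andP[Su Qb] ->.
  by have /forall_inP/(_ b Qb)/forallP/(_ j) := H u Su.
apply/forall_inP => b Qb; apply/forallP => j; apply: H.
by apply/imsetP; exists (u, b, j); rewrite // !inE Su Qb.
Qed.

Lemma prob_all_present S Q :
  Pr (all_present S Q) = 2^-1 ^+ (#|S| * #|Q| * t).
Proof.
rewrite (eq_prob _ (all_presentE S Q)) prob_silent card_imset //.
by rewrite !cardsX cardsT card_ord.
Qed.

(** Union bound over the at most n^a N^b choices of the two sides. *)
Lemma prob_exists_present (a b : nat) :
  Pr (fun x => [exists S : {set 'I_n}, exists Q : {set 'I_N},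
        [&& #|S| == a, #|Q| == b & all_present S Q x]])
  <= (n ^ a * N ^ b)%:R * 2^-1 ^+ (a * b * t).
Proof.
pose A := setX [set S : {set 'I_n} | #|S| == a] [set Q : {set 'I_N} | #|Q| == b].
apply: (@le_trans _ _ (#|A|%:R * 2^-1 ^+ (a * b * t))); last first.
  rewrite ler_wpM2r ?exprn_ge0 ?invr_ge0 // ler_nat cardsX !card_draws !card_ord.
  by rewrite leq_mul ?bin_leq_expn.
apply: le_trans (prob_exists (A := A) (E := fun z => all_present z.1 z.2) _); last first.
  by move=> [S Q]; rewrite !inE /= => /andP[/eqP <- /eqP <-]; rewrite prob_all_present.
apply: le_prob => x /existsP[S /existsP[Q /and3P[cS cQ H]]].
by apply/exists_inP; exists (S, Q) => //; rewrite !inE cS.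
Qed.

Section Common.
Variables (S : {set 'I_n}) (K M : nat) (col : 'I_K * 'I_M -> 'I_N).
Hypothesis col_inj : injective col.
Let q : R := 2^-1 ^+ (#|S| * t).

Definition common (x : tape) (b : 'I_N) : bool := [forall u in S, present x u b].

Lemma commonE x b : common x b = all_present S [set b] x.
Proof.
apply/forall_inP/forall_inP => H u /H; first by move=> Hu; apply/forall_inP => c /set1P ->.
by move/forall_inP; apply; rewrite inE.
Qed.

(** Distinct columns use disjoint sets of coins by [pos_inj], so their failures are independent. *)
Lemma prob_no_common (j : 'I_K) :
  Pr (fun x => all (fun b => ~~ common x b) [seq col (j, i) | i <- enum 'I_M])
  = (1 - q) ^+ M.
Proof.
rewrite (prob_forall_indep (D := fun b => block S [set b]) (p := 1 - q)).
- by rewrite size_map size_enum_ord.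
- by rewrite map_inj_uniq ?enum_uniq // => i i' /col_inj [].
- move=> b x y eqxy; rewrite !commonE !all_presentE; congr (~~ _).
  exact: depends_silent.
- move=> b c ne; rewrite -setI_eq0; apply/eqP/setP => i; rewrite !inE.
  apply/negP => /andP[/imsetP[[[u1 b1] j1] H1 ->] /imsetP[[[u2 b2] j2] H2 /pos_inj[_ Eb _]]].
  move: H1 H2; rewrite !inE !andbT => /andP[_ /eqP E1] /andP[_ /eqP E2].
  by move: ne; rewrite -E1 -E2 Eb eqxx.
- move=> b; rewrite [LHS](_ : _ = Pr (predC (all_present S [set b]))).
    by rewrite prob_predC ?tapes_gt0 // prob_all_present cards1 muln1.
  by apply: eq_prob => x; rewrite /= commonE.
Qed.

(** Failure forces some block [j] to have no common column; the K blocks are handled by the union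
    bound. *)
Lemma prob_many_common : K%:R * (1 - q) ^+ M <= 1 / 10 ->
  9 / 10 <= Pr (fun x => [exists f : {ffun 'I_K -> 'I_N},
               injectiveb f && [forall j, common x (f j)]]).
Proof.
move=> small; set E := (E in Pr E).
have bad : Pr (predC E) <= 1 / 10.
  apply: le_trans small.
  have -> : K%:R = #|[set: 'I_K]|%:R :> R by rewrite cardsT card_ord.
  apply: le_trans (prob_exists (A := setT) (E := fun j x => all
    (fun b => ~~ common x b) [seq col (j, i) | i <- enum 'I_M]) _); last first.
    by move=> j _; rewrite prob_no_common.
  apply: le_prob => x; apply: contraR; rewrite negb_exists_in => /forall_inP H.
  have ex j : exists i, common x (col (j, i)).
    have := H j (in_setT _); rewrite -has_predC => /hasP[b /mapP[i _ ->]] /=.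
    by rewrite negbK; exists i.
  (* One column per block: injectivity of [col] makes these columns distinct. *)
  pose f j := col (j, xchoose (ex j)).
  apply/existsP; exists (finfun f); apply/andP; split.
    by apply/injectiveP => j1 j2; rewrite !ffunE => /col_inj[].
  by apply/forallP => j; rewrite ffunE; exact: (xchooseP (ex j)).
by move: bad; rewrite prob_predC ?tapes_gt0 //; lra.
Qed.
End Common.
End Columns.

Local Open Scope nat_scope.

(** * Cliques and bicliques *)

Lemma subset_card_exists (T : finType) (S : {set T}) (m : nat) :
  m <= #|S| -> exists2 S' : {set T}, (S' \subset S) & (#|S'| = m).
Proof.
move=> lem; exists [set y | y \in take m (enum S)].
  by apply/subsetP => y; rewrite inE => /mem_take; rewrite mem_enum.
rewrite cardsE (card_uniqP _) ?take_uniq ?enum_uniq // size_takel //.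
by rewrite -cardE.
Qed.

Section OutGraph.
Variables (n N t : nat) (tape : seq bool) (gm : nat -> nat).

Definition out_adj : rel 'I_(n * n + N) :=
  fun x y => link n N t tape gm (minn x y) (maxn x y).

Lemma out_adj_sym : symmetric out_adj.
Proof. by move=> x y; rewrite /out_adj minnC maxnC. Qed.

Lemma out_adj_irr : irreflexive out_adj.
Proof. by move=> x; rewrite /out_adj minnn maxnn /link; case: ltnP. Qed.

Definition out_graph : graph := Graph out_adj_sym out_adj_irr.
End OutGraph.

(** * Positions of the coins on the tape *)

Section Positions.
Variables (n N t len : nat).
Hypothesis le_len : n * N * t <= len.

Lemma pos_lt (z : 'I_n * 'I_N * 'I_t) : (z.1.1 * N + z.1.2) * t + z.2 < n * N * t.
Proof. by rewrite !mulD_lt. Qed.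

(** Mixed-radix numbering that matches the program: dividing by [t] recovers the index u N + b in
    the [hit] table. The tape may be longer than the coins used. *)
Definition pos (z : 'I_n * 'I_N * 'I_t) : 'I_len := widen_ord le_len (Ordinal (pos_lt z)).

Lemma mulD_inj a b c d m : b < m -> d < m -> a * m + b = c * m + d -> a = c /\ b = d.
Proof.
move=> ltb ltd E; have := congr1 (fun x => (x %/ m, x %% m)) E.
by rewrite !divnMDl ?(leq_ltn_trans _ ltb) // !modnMDl !divn_small // !modn_small // !addn0 => -[].
Qed.

Lemma pos_inj : injective pos.
Proof.
move=> [[u b] j] [[u' b'] j'] /(congr1 val) /= /mulD_inj[] // /mulD_inj[] // Eu Eb Ej.
by congr (_, _, _); apply: val_inj.
Qed.

(** Connects the table filled by the program with the events whose probabilities are estimated. *)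
Lemma presentE (x : len.-tuple bool) (u : 'I_n) (b : 'I_N) :
  present pos x u b = ~~ hit x t (n * N * t) (u * N + b).
Proof.
apply/forallP/idP => [H|H j].
  apply/hasP => -[p]; rewrite mem_iota add0n => /= ltp /andP[/eqP Eg].
  have t_gt0 : 0 < t by move: ltp; case: (posnP t) => // ->; rewrite muln0.
  have := H (Ordinal (ltn_pmod p t_gt0)); rewrite (tnth_nth false) /=.
  by rewrite -Eg -divn_eq => /negPf ->.
apply: contra H; rewrite (tnth_nth false) /= => xj.
apply/hasP; exists ((u * N + b) * t + j); first by rewrite mem_iota (pos_lt (u, b, j)).
by rewrite divnMDl ?(leq_ltn_trans _ (ltn_ord j)) // divn_small // addn0 eqxx.
Qed.
End Positions.

(** * Bicliques of the output graph against cliques of the input *)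

Section Reduction.
Variables (G : graph) (N t len : nat).
Let n := nverts G.
Hypothesis le_len : n * N * t <= len.
Variable x : len.-tuple bool.
Let H := out_graph n N t x (input_mem G).
Let prs := present (pos le_len) x.

Lemma input_mem_adj (u v : 'I_n) : input_mem G (u * n + v) = adj u v.
Proof.
rewrite /input_mem; congr (nat_of_bool _).
apply/existsP/idP => [[i /existsP[j /andP[/eqP E]]]|uv].
  by have [/val_inj -> /val_inj ->] := mulD_inj (ltn_ord v) (ltn_ord j) E.
by exists u; apply/existsP; exists v; rewrite eqxx.
Qed.

Definition pair_vtx (u v : 'I_n) : 'I_(n * n + N) :=
  lshift N (Ordinal (mulD_lt (ltn_ord u) (ltn_ord v))).
Definition col_vtx (b : 'I_N) : 'I_(n * n + N) := rshift (n * n) b.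

Lemma adj_pair_col (u v : 'I_n) (b : 'I_N) :
  adj (pair_vtx u v : 'I_(nverts H)) (col_vtx b) = [&& (u == v) || adj u v, prs u b & prs v b].
Proof.
have ltp : u * n + v < n * n by exact: mulD_lt.
have lep : u * n + v <= n * n + b by rewrite ltnW // (leq_trans ltp) ?leq_addr.
have n_gt0 : 0 < n by exact: leq_ltn_trans (ltn_ord u).
rewrite /= /out_adj /= (minn_idPl lep) (maxn_idPr lep) /link ltp leq_addr addKn.
rewrite divnMDl // modnMDl divn_small // modn_small // addn0 input_mem_adj.
by rewrite /prs !presentE eqb0 negbK.
Qed.

Lemma vtx_cases (a : 'I_(n * n + N)) :
  (a < n * n /\ exists u v, a = pair_vtx u v) \/ (n * n <= a /\ exists b, a = col_vtx b).
Proof.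
case: (split_ordP a) => [p ->|b ->]; [left|right]; last by split; [rewrite leq_addr|exists b].
split=> //; have n_gt0 : 0 < n by case: n p => // -[].
have ltu : p %/ n < n by rewrite ltn_divLR.
exists (Ordinal ltu), (Ordinal (ltn_pmod p n_gt0)).
by apply: val_inj; rewrite /= -divn_eq.
Qed.

(** The output graph is bipartite between pairs and columns, so the side of one endpoint fixes that
    of the other. *)
Lemma adj_sides (a b : 'I_(nverts H)) : adj a b -> (a < n * n) = (n * n <= b).
Proof.
rewrite /= /out_adj /link => /and3P[+ + _].
have aux p q d : minn p q < d -> d <= maxn p q -> (p < d) = (d <= q) by lia.
exact: aux.
Qed.

(** One side consists of all k^2 ordered pairs of clique vertices, indexed by quotient and remainder
    modulo k. The diagonal pairs are joined to the columns because [link] admits equal endpoints. *)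
Lemma contains_biclique_of_clique k (f : {ffun 'I_(k ^ 2) -> 'I_N}) (c : {ffun 'I_k -> 'I_n}) :
  injective f -> injective c -> (forall i j, i != j -> adj (c i) (c j)) ->
  (forall i j, prs (c i) (f j)) ->
  contains (biclique (k ^ 2) (k ^ 2)) H.
Proof.
move=> f_inj c_inj cadj cf.
have divk (i : 'I_(k ^ 2)) : i %/ k < k.
  by rewrite ltn_divLR ?mulnn //; case: k i {f c f_inj c_inj cadj cf} => // -[].
have modk (i : 'I_(k ^ 2)) : i %% k < k.
  by rewrite ltn_mod; case: k i {f c f_inj c_inj cadj cf divk} => // -[].
pose e (i : 'I_(k ^ 2)) := pair_vtx (c (Ordinal (divk i))) (c (Ordinal (modk i))).
pose h (z : 'I_(k ^ 2 + k ^ 2)) : 'I_(nverts H) :=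
  match split z with inl i => e i | inr j => col_vtx (f j) end.
have hl i : h (lshift (k ^ 2) i) = e i by rewrite /h (unsplitK (inl i)).
have hr i : h (rshift (k ^ 2) i) = col_vtx (f i) by rewrite /h (unsplitK (inr i)).
have e_inj : injective e.
  move=> i i' /(congr1 val) /= /mulD_inj[] // /val_inj /c_inj [E1] /val_inj /c_inj [E2].
  by apply: val_inj; rewrite /= (divn_eq i k) (divn_eq i' k) E1 E2.
have eadj i j : adj (e i : 'I_(nverts H)) (col_vtx (f j)).
  rewrite adj_pair_col !cf !andbT.
  case: eqVneq => //= ne; apply: cadj; apply: contraNneq ne => E.
  by rewrite (inj_eq c_inj) E.
have e_lt i : e i < n * n by rewrite /= mulD_lt.
apply/existsP; exists (finfun h); apply/andP; split.
  apply/injectiveP => z z'; rewrite !ffunE.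
  case: (split_ordP z) => i ->; case: (split_ordP z') => j ->; rewrite ?hl ?hr.
  - by move/e_inj ->.
  - by move/(congr1 val) => E; have := e_lt i; rewrite E ltnNge leq_addr.
  - by move/(congr1 val) => E; have := e_lt j; rewrite -E ltnNge leq_addr.
  by move/rshift_inj/f_inj ->.
apply/forallP => z; apply/forallP => z'; apply/implyP; rewrite !ffunE [adj z _]/= /biclique_adj.
case: (split_ordP z) => i ->; case: (split_ordP z') => j ->; rewrite ?hl ?hr /=;
  rewrite ?ltn_ord ?(ltnNge (_ + _)) ?leq_addr //= => _; first exact: eadj.
by rewrite out_adj_sym; exact: eadj.
Qed.

Lemma biclique_sides k (s r : 'I_(k ^ 2) -> 'I_(nverts H)) :
  0 < k -> injective s -> injective r -> (forall i j, adj (s i) (r j)) ->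
  (forall i, s i < n * n) ->
  contains (clique k) G \/
  exists S : {set 'I_n}, exists Q : {set 'I_N},
    [&& #|S| == k.+1, #|Q| == k ^ 2 & all_present (pos le_len) S Q x].
Proof.
move=> k_gt0 s_inj r_inj sr s_lt.
have k2_gt0 : 0 < k ^ 2 by rewrite expn_gt0 k_gt0.
pose o : 'I_(k ^ 2) := Ordinal k2_gt0.
have n_gt0 : 0 < n by move: (s_lt o); case: n => //; rewrite ltn0.
have sP i : exists uv : 'I_n * 'I_n, s i == pair_vtx uv.1 uv.2.
  have [[_ [u [v ->]]]|[le _]] := vtx_cases (s i); first by exists (u, v).
  by have := s_lt i; rewrite ltnNge le.
have rP j : exists b : 'I_N, r j == col_vtx b.
  have [[lt _]|[_ [b ->]]] := vtx_cases (r j); last by exists b.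
  by have := adj_sides (sr o j); rewrite s_lt leqNgt lt.
pose p i := xchoose (sP i); pose b j := xchoose (rP j).
have pE i : s i = pair_vtx (p i).1 (p i).2 by exact/eqP/(xchooseP (sP i)).
have bE j : r j = col_vtx (b j) by exact/eqP/(xchooseP (rP j)).
have p_inj : injective p by move=> i i' E; apply: s_inj; rewrite !pE E.
have b_inj : injective b by move=> j j' E; apply: r_inj; rewrite !bE E.
have srP i j : [&& ((p i).1 == (p i).2) || adj (p i).1 (p i).2,
                   prs (p i).1 (b j) & prs (p i).2 (b j)].
  by rewrite -adj_pair_col -pE -bE.
pose X := p @: setT; pose Q := b @: setT.
(* The endpoints of the k^2 pairs; every one of them is joined to every column of [Q]. *)
pose S := [set uv.1 | uv in X] :|: [set uv.2 | uv in X].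
have cX : #|X| = k ^ 2 by rewrite card_imset // cardsT card_ord.
have cQ : #|Q| = k ^ 2 by rewrite card_imset // cardsT card_ord.
have XS : X \subset setX S S.
  apply/subsetP => -[u v] Xuv; rewrite !inE; apply/andP; split; apply/orP; [left|right];
  by apply/imsetP; exists (u, v).
have SQ u c : u \in S -> c \in Q -> prs u c.
  move=> Su /imsetP[j _ ->]; move: Su; rewrite inE.
  by case/orP=> /imsetP[_ /imsetP[i _ ->] ->]; have /and3P[] := srP i j.
have [leS|ltS] := leqP #|S| k; [left|right]; last first.
  have [S' sS cS] := subset_card_exists ltS; exists S', Q; rewrite cS cQ !eqxx /=.
  apply/forall_inP => u Su; apply/forall_inP => c Qc; apply: SQ => //.
  exact: (subsetP sS).
(* The k^2 pairs lie in S * S, so k^2 <= |S|^2; with |S| <= k both are equalities, and the pairs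
   fill S * S. *)
have cS : #|S| = k.
  apply/eqP; rewrite eqn_leq leS -leq_sqr -cX -mulnn -cardsX.
  exact: subset_leq_card.
have XE : X = setX S S.
  by apply/eqP; rewrite eqEcard XS cardsX cS cX mulnn leqnn.
pose c (i : 'I_k) : 'I_n := enum_val (cast_ord (esym cS) i).
have cSi i : c i \in S := enum_valP (cast_ord (esym cS) i).
have c_inj : injective c by move=> i j /enum_val_inj /cast_ord_inj.
apply/existsP; exists (finfun c); apply/andP; split.
  by apply/injectiveP => i j; rewrite !ffunE; exact: c_inj.
apply/forallP => i; apply/forallP => j; apply/implyP; rewrite /= /clique_adj !ffunE => ne.
have : (c i, c j) \in X by rewrite XE in_setX !cSi.
(* The pair occurs in the biclique; its adjacency to the column [o] forces an edge of [G]. *)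
case/imsetP=> l _ E; have /andP[] := srP l o; rewrite -E /= (inj_eq c_inj) (negPf ne).
by [].
Qed.

Lemma contains_clique_or_block k : 0 < k ->
  contains (biclique (k ^ 2) (k ^ 2)) H ->
  contains (clique k) G \/
  exists S : {set 'I_n}, exists Q : {set 'I_N},
    [&& #|S| == k.+1, #|Q| == k ^ 2 & all_present (pos le_len) S Q x].
Proof.
move=> k_gt0 /existsP[f /andP[/injectiveP f_inj /forallP fadj]].
have k2_gt0 : 0 < k ^ 2 by rewrite expn_gt0 k_gt0.
pose o : 'I_(k ^ 2) := Ordinal k2_gt0.
pose s i := f (lshift (k ^ 2) i); pose r j := f (rshift (k ^ 2) j).
have s_inj : injective s by move=> i j /f_inj/lshift_inj.
have r_inj : injective r by move=> i j /f_inj/rshift_inj.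
have sr i j : adj (s i) (r j).
  have /forallP/(_ (rshift (k ^ 2) j))/implyP := fadj (lshift (k ^ 2) i); apply.
  by rewrite /= /biclique_adj /= ltn_ord ltnNge leq_addr.
have rs i j : adj (r i) (s j) by rewrite adj_sym.
(* The biclique may be embedded either way round; the side of one vertex decides which part consists
   of pairs. *)
have [lt|ge] := ltnP (s o) (n * n).
  apply: (biclique_sides k_gt0 s_inj r_inj sr) => i.
  by rewrite (adj_sides (sr i o)) -(adj_sides (sr o o)).
apply: (biclique_sides k_gt0 r_inj s_inj rs) => i.
by rewrite (adj_sides (rs i o)).
Qed.
End Reduction.

(** * Running time, success probability and conclusion *)

Definition time_factor : nat :=
  cost setup + (cost log_body).+1 + cost parameters + (cost flip_body).+1 +
  cost rewind + (cost out_body).+1 + cost result + 9.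

(** Each multiplier in [steps] (1, L, the number of flips, V^2) is at most n^6, and [time_factor] is
    the sum of their coefficients. *)
Lemma steps_le n k : 2 < k -> (2 * k ^ (4 * k ^ 2 + k + 3)) ^ ((k + 1) * k ^ 4) < n ->
  steps n k <= time_factor * n ^ 6.
Proof.
move=> k_ge3 n_big; have nverts_gt1 := nverts_gt1 k_ge3 n_big.
have leL : levels n <= n ^ 6.
  by apply: leq_trans (levels_le k_ge3 n_big) _; rewrite mulnn leq_exp2l.
have lem := coins_le k_ge3 n_big; have leV := out_matrix_le k_ge3 n_big.
have n6 : 0 < n ^ 6 by rewrite expn_gt0 ltnW.
rewrite /time_factor /steps.
move: (cost setup) (cost log_body) (cost parameters) (cost flip_body) (cost rewind)
  (cost out_body) (cost result) => c1 c2 c3 c4 c5 c6 c7; rewrite 6!(mulnDl (_ + _)) (mulnDl c1).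
have mul_le a c : a <= n ^ 6 -> a * c <= c * n ^ 6.
  by move=> lea; rewrite mulnC leq_mul2l lea orbT.
have const_le c : c <= c * n ^ 6 by rewrite leq_pmulr.
do 7![apply: leq_add; last by first [exact: const_le|exact: mul_le]]; exact: const_le.
Qed.

Lemma input_mem_out G a : nverts G * nverts G <= a -> input_mem G a = 0.
Proof.
move=> lea; rewrite /input_mem; case: existsP => // -[i /existsP[j /andP[/eqP E _]]].
by move: lea; rewrite E leqNgt mulD_lt.
Qed.

Lemma reduction_computes (G : graph) k (x : seq bool) : 2 < k ->
  (2 * k ^ (4 * k ^ 2 + k + 3)) ^ ((k + 1) * k ^ 4) < nverts G ->
  computes_within reduction_cmd 9 (time_factor * nverts G ^ 6) G k x
    (out_graph (nverts G) (cols (nverts G) k) (depth (nverts G) k) x (input_mem G)).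
Proof.
move=> k_ge3 n_big; set n := nverts G in n_big *.
have k_gt0 : 0 < k by lia.
have Vw := out_nverts3_lt_word k_ge3 n_big; have nverts_gt1 := nverts_gt1 k_ge3 n_big.
have [s [S0 S1 Sm] [T leT run]] := exec_reduction (s0 := (init reduction_cmd G k x).2)
  nverts_gt1 k_gt0 Vw (@input_mem_out G) erefl erefl erefl erefl erefl erefl.
have ex : exec (word_size 9 n) reduction_cmd (init reduction_cmd G k x).2 s
    (time_factor * n ^ 6).
  by exists T => //; apply: leq_trans leT _; exact: steps_le.
rewrite /computes_within /halted_with (exec_halted ex) S0 S1; split=> //.
  apply: leq_trans (ltnW Vw); rewrite -mulnn; apply: output_le; first by lia.
  exact: cols_gt1.
move=> i j; rewrite Sm /out_bit /=; last by rewrite mulD_lt.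
by rewrite divnMDl ?(leq_ltn_trans _ (ltn_ord j)) // modnMDl divn_small // modn_small // addn0.
Qed.

Local Open Scope ring_scope.

(** Raising both sides to the power (k + 1) k^4 removes the real exponent. *)
Lemma size_hypothesis (R : realType) (n k : nat) : (0 < k)%N ->
  n%:R `^ (1 / ((k + 1) * k ^ 4)%N%:R) > 2 * k%:R ^+ (4 * k ^ 2 + k + 3) :> R ->
  ((2 * k ^ (4 * k ^ 2 + k + 3)) ^ ((k + 1) * k ^ 4) < n)%N.
Proof.
move=> k_gt0; set m := ((k + 1) * _)%N; set e := (_ + 3)%N => lt.
have m_gt0 : (0 < m)%N by rewrite muln_gt0 addn1 expn_gt0 k_gt0.
rewrite -(ltr_nat R) natrX natrM natrX.
apply: lt_le_trans (_ : (n%:R `^ (1 / m%:R)) ^+ m <= _).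
  by rewrite ltrXn2r ?mulr_ge0 ?exprn_ge0 // lt0n_neq0.
by rewrite -powR_mulrn ?powR_ge0 // -powRrM div1r mulVf ?powRr1 // pnatr_eq0 -lt0n.
Qed.

Lemma prob_block_le (R : realType) n k len (le_len : (n * cols n k * depth n k <= len)%N) :
  (2 < k)%N -> ((2 * k ^ (4 * k ^ 2 + k + 3)) ^ ((k + 1) * k ^ 4) < n)%N ->
  uniform_prob R (fun x : len.-tuple bool =>
    [exists S : {set 'I_n}, exists Q : {set 'I_(cols n k)},
       [&& #|S| == k.+1, #|Q| == (k ^ 2)%N & all_present (pos le_len) S Q x]]) <= 1 / 10.
Proof.
move=> k_ge3 n_big; apply: le_trans (prob_exists_present _ (@pos_inj _ _ _ _ _) _ _) _.
rewrite exprVn ler_pdivrMr ?exprn_gt0 // mul1r ler_pdivlMl // -natrX -natrM ler_nat.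
exact: blocks_small.
Qed.

Lemma prob_many_common_ge (R : realType) n k len (le_len : (n * cols n k * depth n k <= len)%N)
    (S : {set 'I_n}) : (2 < k)%N -> #|S| = k ->
  9 / 10 <= uniform_prob R (fun x : len.-tuple bool =>
    [exists f : {ffun 'I_(k ^ 2) -> 'I_(cols n k)},
       injectiveb f && [forall j, common (pos le_len) S x (f j)]]).
Proof.
move=> k_ge3 cS; set M := (16 * (k * k) * 2 ^ levels n)%N.
have colsE : (k ^ 2 * M = cols n k)%N by rewrite /M /cols -mulnn; ring.
have col_lt (z : 'I_(k ^ 2) * 'I_M) : (z.1 * M + z.2 < cols n k)%N.
  by rewrite -colsE mulD_lt.
pose col z := Ordinal (col_lt z).
have col_inj : injective col.
  move=> [i j] [i' j'] /(congr1 val) /= /mulD_inj[] // Ei Ej.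
  by congr (_, _); apply: val_inj.
apply: (prob_many_common (pos_inj (le_len := le_len)) col_inj).
set q : R := 2^-1 ^+ _.
have q_gt0 : 0 < q by rewrite exprn_gt0 // invr_gt0.
have q_le1 : q <= 1 by apply: exprn_ile1; lra.
(* Here q = 2^-(k t) and k t <= L, while M = 16 k^2 2^L. *)
have Mq : 16 * (k ^ 2)%:R <= M%:R * q.
  rewrite /q exprVn ler_pdivlMr ?exprn_gt0 // cS -natrX -!natrM ler_nat /M -mulnn.
  by rewrite leq_mul2l leq_exp2l // depth_mul_le orbT.
have K_gt0 : 0 < (k ^ 2)%:R :> R by rewrite ltr0n expn_gt0; lia.
have := @expr1B_mul_le1 _ q M; rewrite (ltW q_gt0) q_le1 => /(_ isT) bern.
have pow_ge0 : 0 <= (1 - q) ^+ M by rewrite exprn_ge0 // subr_ge0.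
move: (k ^ 2)%:R (M%:R * q) ((1 - q) ^+ M) Mq K_gt0 bern pow_ge0 => K a p.
(* From p (1 + a) <= 1 and a >= 16 K follows K p <= K / (1 + 16 K) < 1 / 10. *)
by nra.
Qed.

Theorem theorem2 (R : realType) :
  exists (P : cmd) (c C : nat),
  forall (n k : nat) (G : graph),
    nverts G = n ->
    (3 <= k)%N ->
    n%:R `^ (1 / ((k + 1) * k ^ 4)%N%:R) > 2 * k%:R ^+ (4 * k ^ 2 + k + 3) :> R ->
    exists G' : (C * n ^ 6).-tuple bool -> graph,
      (forall r : (C * n ^ 6).-tuple bool,
         computes_within P c (C * n ^ 6) G k r (G' r)) /\
      9 / 10 <= uniform_prob R (fun r : (C * n ^ 6).-tuple bool =>
                        contains (biclique (k ^ 2) (k ^ 2)) (G' r)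
                        == contains (clique k) G).
Proof.
exists reduction_cmd, 9%N, time_factor => n k G <- k_ge3 hyp.
have k_gt0 : (0 < k)%N by lia.
have n_big := size_hypothesis k_gt0 hyp.
exists (fun r => out_graph (nverts G) (cols (nverts G) k) (depth (nverts G) k) r (input_mem G)).
split=> [r|]; first exact: reduction_computes.
have le_len : (nverts G * cols (nverts G) k * depth (nverts G) k <= time_factor * nverts G ^ 6)%N.
  by apply: leq_trans (coins_le k_ge3 n_big) _; rewrite leq_pmull.
(* [G] is fixed, so each case calls for only one of the two random events, and 9/10 is reached
   without combining their failures. *)
case: (boolP (contains (clique k) G)) => [|noK].
  move=> /existsP[c /andP[/injectiveP c_inj /forallP cadj]].
  have cS : #|c @: setT| = k by rewrite card_imset // cardsT card_ord.
  apply: le_trans (prob_many_common_ge R le_len k_ge3 cS) _.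
  apply: le_prob => r /existsP[f /andP[/injectiveP f_inj /forallP fcom]].
  rewrite eqb_id; apply: (contains_biclique_of_clique (le_len := le_len) f_inj c_inj).
    by move=> i j ne; have /forallP/(_ j)/implyP := cadj i; exact.
  by move=> i j; have /forall_inP := fcom j; apply; exact: imset_f.
have := prob_block_le R le_len k_ge3 n_big; set E := (E in uniform_prob R E) => bad.
apply: (@le_trans _ _ (uniform_prob R (predC E))).
  by rewrite prob_predC ?tapes_gt0 //; lra.
apply: le_prob => r; rewrite /= eqbF_neg; apply: contra => /(contains_clique_or_block le_len k_gt0).
case=> [K|[S [Q H]]]; first by rewrite K in noK.
by apply/existsP; exists S; apply/existsP; exists Q.
Qed.
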